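(* Let $G$ be a connected finite simple graph such that $\nu(G')=\eta(G')$ for every induced subgraph $G'$ of $G$. Then $G$ is bipartite, or complete multipartite, or a blowup of a cycle.
   Context: For an $n$-vertex digraph $D$ (no loops), a permutation of $D$ is a bijection $\sigma:V(D)\to[n]$; an arc $u\to v$ is a descent of $\sigma$ if $\sigma(u)>\sigma(v)$, and $\mathrm{des}_D(\sigma)$ is the number of descents. $A_D(t)=\sum_{\sigma}t^{\mathrm{des}_D(\sigma)}$ over all such bijections. For a graph $G$, $\nu(G):=|A_D(-1)|$ where $D$ is any orientation of $G$ (independent of the orientation). An ordering $(\pi_1,\dots,\pi_n)$ of $V(G)$ is an even sequence if $G[\{\pi_1,\dots,\pi_i\}]$ has an even number of edges for every $1\le i\le n$; $\eta(G)$ is the number of even sequences. Complete multipartite: vertex set partitioned into $V_1,\dots,V_r$ with $u,v$ adjacent iff in different parts. Blowup of a cycle: vertex set partitioned into $V_1,\dots,V_r$ with $u,v$ adjacent iff $u\in V_i$, $v\in V_{i+1}$ for some $i$ (indices mod $r$). *)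

(* Defs.v *)
From mathcomp Require Import all_boot all_order all_algebra.

Set Implicit Arguments.
Unset Strict Implicit.
Unset Printing Implicit Defensive.

Import GRing.Theory Num.Theory.

(** A finite simple graph is a symmetric irreflexive [e : rel T] on a finType
    [T]; a digraph is a relation [d : rel T], with [d u v] meaning u -> v. *)

Section Eulerian.

Variable T : finType.
Implicit Types (d e : rel T) (s : {ffun T -> 'I_#|T|}).

(** Labels are numbered from 0, so [n] is encoded as {0, ..., n-1}. *)
Definition labelings : {set {ffun T -> 'I_#|T|}} :=
  [set s : {ffun T -> 'I_#|T|} | injectiveb s].

Lemma labelingsP s : reflect (bijective s) (s \in labelings).
Proof.
rewrite inE; apply: (iffP (injectiveP s)) => [sI | /bij_inj //].
by apply: inj_card_bij; rewrite ?card_ord.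
Qed.

Definition descents d s : {set T * T} :=
  [set a | d a.1 a.2 && (s a.2 < s a.1)].

Definition des d s : nat := #|descents d s|.

Definition eulerian d : {poly int} := (\sum_(s in labelings) 'X^(des d s))%R.

Definition orientation e d : Prop :=
  (forall u v, e u v = d u v || d v u) /\
  (forall u v, ~~ (d u v && d v u)).

Definition std_orientation e : rel T :=
  [rel u v | e u v && (enum_rank u < enum_rank v)].

(** [nu] does not depend on the orientation: see [nuE]. *)
Definition nu e : nat := `|(eulerian (std_orientation e)).[-1]%R|%N.

Lemma std_orientationP e :
  symmetric e -> irreflexive e -> orientation e (std_orientation e).
Proof.
move=> eS eI; split=> u v /=; last first.
  by apply/negP => /andP[/andP[_ h1] /andP[_ h2]]; move: (ltn_trans h1 h2); rewrite ltnn.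
rewrite /std_orientation /= (eS v u) -andb_orr -neq_ltn.
have [E|_] := eqVneq (enum_rank u) (enum_rank v).
  by rewrite (enum_rank_inj E) eI.
case: eqP => [/val_inj E|]; last by rewrite andbT.
by rewrite (enum_rank_inj E) eI.
Qed.

Lemma odd_des_orientation e d d' s :
  orientation e d -> orientation e d' -> s \in labelings ->
  odd (des d' s) = odd (des d s) (+) odd #|[set a | d a.1 a.2 && ~~ d' a.1 a.2]|.
Proof.
move=> [dE dA] [d'E d'A]; rewrite inE => /injectiveP sI.
pose R := [set a : T * T | d' a.1 a.2].
pose R0 := [set a : T * T | d a.1 a.2].
rewrite /des -(cardsID R (descents d s)) -(cardsID R0 (descents d' s)).
have -> : descents d' s :&: R0 = descents d s :&: R.
  by apply/setP=> a; rewrite !inE; do !case: (_ a.1 a.2); rewrite ?andbF ?andbT.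
pose sw (a : T * T) := (a.2, a.1).
have swK : involutive sw by case.
rewrite -(card_imset (descents d' s :\: R0) (inv_inj swK)).
rewrite -(cardsID (descents d s) [set a | d a.1 a.2 && ~~ d' a.1 a.2]).
have -> : [set a | d a.1 a.2 && ~~ d' a.1 a.2] :&: descents d s = descents d s :\: R.
  by apply/setP=> a; rewrite !inE; case: (d _ _); case: (d' _ _); rewrite ?andbF ?andbT.
have -> : [set a | d a.1 a.2 && ~~ d' a.1 a.2] :\: descents d s
   = sw @: (descents d' s :\: R0).
  apply/setP=> -[u v]; rewrite (can2_imset_pre _ swK swK) !inE /=.
  move: (dE u v) (d'E u v) (dA u v) (d'A u v) => ->.
  case duv: (d u v); case dvu: (d v u); case: (d' u v); case d'vu: (d' v u) => //= _ _ _; rewrite ?andbF //.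
  rewrite andbT -leqNgt leq_eqVlt; case: eqP => //= /val_inj /sI E.
  by subst v; rewrite duv in dvu.
by rewrite !oddD -addbA addKb.
Qed.

Lemma nuE e d : symmetric e -> irreflexive e -> orientation e d ->
  nu e = `|(eulerian d).[-1]%R|%N.
Proof.
move=> eS eI od; have od0 := std_orientationP eS eI.
rewrite /nu /eulerian !horner_sum.
rewrite (eq_bigr (fun s =>
  (-1) ^+ #|[set a | d a.1 a.2 && ~~ std_orientation e a.1 a.2]| * 'X^(des d s).[-1])%R).
  by rewrite -mulr_sumr abszM abszX exp1n mul1n.
move=> s sL; rewrite !hornerXn -exprD -[LHS]signr_odd -[RHS]signr_odd.
by rewrite (odd_des_orientation od od0 sL) oddD addbC.
Qed.

End Eulerian.

Section Graphs.

Variable T : finType.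
Implicit Types (e : rel T) (A : {set T}).

Definition induced_edges e A : {set {set T}} :=
  [set E : {set T} | (E \subset A) &&
     [exists u, exists v, e u v && (E == [set u; v])]].

Definition even_sequence e (p : #|T|.-tuple T) : bool :=
  uniq p &&
  [forall i : 'I_#|T|, ~~ odd #|induced_edges e [set x in take i.+1 p]|].

Definition eta e : nat := #|[set p : #|T|.-tuple T | even_sequence e p]|.

Definition induced e A : rel {x : T | x \in A} := [rel u v | e (val u) (val v)].

Definition connected_graph e : Prop := forall u v, connect e u v.

Definition bipartite e : Prop :=
  exists A, forall u v, e u v -> (u \in A) != (v \in A).

Definition vertex_partition (r : nat) (V : 'I_r -> {set T}) : Prop :=
  (forall i, V i != set0) /\ (forall u, exists! i, u \in V i).

Definition complete_multipartite e : Prop :=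
  exists (r : nat) (V : 'I_r -> {set T}), vertex_partition V /\
    forall u v, e u v <-> exists i j, [/\ i != j, u \in V i & v \in V j].

(** [ordS] is the cyclic successor on 'I_r. *)
Definition cycle_blowup e : Prop :=
  exists (r : nat) (V : 'I_r -> {set T}), [/\ 3 <= r, vertex_partition V &
    forall u v, e u v <-> exists i,
      (u \in V i /\ v \in V (ordS i)) \/ (v \in V i /\ u \in V (ordS i))].

End Graphs.

Arguments induced [T] e A.

(* Main.v *)
Require Import Defs.
From mathcomp Require Import all_boot all_order all_algebra.
From mathcomp Require Import zify ring.

(** Reversing the longest prefix that induces an odd number of edges is a
    sign-reversing involution on the labelings that are not even sequences, so
    [A_D(-1)] is the signed count of the even sequences.  Hence [nu = eta] holds
    exactly when any two even sequences disagree on an even number of edges.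

    An odd cycle with a pendant vertex has two even sequences that order the
    ends of every cycle edge differently and agree on the pendant edge, so it
    cannot be an induced subgraph.  If [c] is a shortest odd cycle, a vertex
    adjacent to [c i] is then also adjacent to [c (i + 2)] or [c (i - 2)], i.e.
    it is a twin of a cycle vertex; replacing that cycle vertex by its twin
    gives another shortest odd cycle, and by connectedness every vertex is a
    twin.  For length 3 this makes non-adjacency transitive, for length at least
    5 the twin classes form a blowup of the cycle. *)

Set Implicit Arguments.
Unset Strict Implicit.
Unset Printing Implicit Defensive.

Import Order.TTheory GRing.Theory Num.Theory.

Section SignSums.

Variables (R : numDomainType) (I : finType).
Local Open Scope ring_scope.

Lemma sumr_sign_reversing (P : pred I) (F : I -> R) (f : I -> I) :
    involutive f -> (forall i, P (f i) = P i) ->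
    (forall i, P i -> F (f i) = - F i) ->
  \sum_(i | P i) F i = 0.
Proof.
move=> fK Pf Ff; apply/eqP; rewrite -eqNr -sumrN; apply/eqP.
rewrite [RHS](reindex_inj (inv_inj fK)).
by apply: eq_big => [i|i /Ff ->] //; rewrite Pf.
Qed.

(* Two terms of opposite signs cancel, leaving only [#|A| - 2] terms. *)
Lemma odd_eq_of_card_le_norm_sum (A : {set I}) (f : I -> nat) :
    #|A|%:R <= `|\sum_(i in A) (-1) ^+ f i : R| ->
  {in A &, forall i j, odd (f i) = odd (f j)}.
Proof.
move=> leA i j iA jA; apply/eqP; apply: contraLR leA => fij.
have jAi : j \in A :\ i.
  by rewrite !inE jA andbT; apply: contraNneq fij => ->.
rewrite (big_setD1 i) //= (big_setD1 j) //= addrA.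
have -> : (-1) ^+ f i + (-1) ^+ f j = 0 :> R.
  by rewrite -signr_odd -[X in _ + X]signr_odd; move: fij;
     case: (odd (f i)); case: (odd (f j)); rewrite ?addNr ?subrr.
rewrite add0r -real_ltNge ?normr_real ?realn //.
apply: le_lt_trans (ler_norm_sum _ _ _) _.
under eq_bigr do rewrite normrX normrN1 expr1n.
rewrite sumr_const ltr_nat [in ltnRHS](cardsD1 i) iA.
by rewrite (cardsD1 j (A :\ i)) jAi.
Qed.

End SignSums.

Section Orderings.

Variable T : finType.
Implicit Types (p : #|T|.-tuple T) (s : {ffun T -> 'I_#|T|}).

Definition index_labeling p : {ffun T -> 'I_#|T|} :=
  [ffun x => insubd (enum_rank x) (index x p)].

Lemma mem_uniq_tuple p x : uniq p -> x \in p.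
Proof.
move/card_uniqP; rewrite size_tuple => /subset_cardP => pT.
by rewrite (pT _) ?subset_predT.
Qed.

Lemma index_labelingE p x : uniq p -> index_labeling p x = index x p :> nat.
Proof.
move=> p_uniq; rewrite ffunE insubdK // -topredE /= -[X in _ < X](size_tuple p).
by rewrite index_mem mem_uniq_tuple.
Qed.

Lemma index_labeling_labelings p : uniq p -> index_labeling p \in labelings T.
Proof.
move=> p_uniq; rewrite inE; apply/injectiveP => x y /(congr1 val) /=.
by rewrite !index_labelingE // => /(index_inj x); apply; apply: mem_uniq_tuple.
Qed.

Lemma index_labeling_inj :
  {in [pred p : #|T|.-tuple T | uniq p] &, injective index_labeling}.
Proof.
move=> p q /= p_uniq q_uniq /ffunP pq; apply: eq_from_tnth => i.
pose x := tnth p i; have xi : index x p = i.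
  by rewrite [x](tnth_nth x) index_uniq // size_tuple.
rewrite -/x [RHS](tnth_nth x) -xi -index_labelingE // pq index_labelingE //.
by rewrite nth_index ?mem_uniq_tuple.
Qed.

Lemma labeling_index s : s \in labelings T ->
  exists2 p : #|T|.-tuple T, uniq p & s = index_labeling p.
Proof.
case/labelingsP => g sK gK; have g_inj := can_inj gK.
have p_uniq : uniq [tuple g i | i < #|T|] by rewrite map_inj_uniq ?enum_uniq.
exists [tuple g i | i < #|T|] => //; apply/ffunP => x; apply/ord_inj.
by rewrite index_labelingE // -{2}(sK x) index_map // index_enum_ord.
Qed.

Lemma monotone_labeling (g : T -> nat) :
  exists2 s, s \in labelings T & forall u v, g u < g v -> s u < s v.
Proof.
pose leg := relpre g leq; pose p := sort_tuple leg (enum_tuple T).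
have leg_trans : transitive leg by move=> y x z; apply: leq_trans.
have leg_refl : reflexive leg by move=> x; apply: leqnn.
have p_uniq : uniq p by rewrite sort_uniq enum_uniq.
exists (index_labeling p) => [|u v]; first exact: index_labeling_labelings.
rewrite !index_labelingE // !ltnNge; apply: contra.
have p_sorted : sorted leg p by apply: sort_sorted => x y; apply: leq_total.
by apply: (sorted_leq_index leg_trans leg_refl p_sorted); apply: mem_uniq_tuple.
Qed.

End Orderings.

Section EvenLabelings.

Variables (T : finType) (e : rel T).
Implicit Types (d : rel T) (s : {ffun T -> 'I_#|T|}) (A : {set T}).

Lemma orientation_neq d u v : orientation e d -> d u v -> u != v.
Proof.
by case=> _ dA duv; apply: contraTneq duv => <-; have := dA u u; rewrite andbb.
Qed.

Definition induced_arcs d A : {set T * T} :=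
  [set a | [&& d a.1 a.2, a.1 \in A & a.2 \in A]].

Lemma card_induced_edges d A : orientation e d ->
  #|induced_edges e A| = #|induced_arcs d A|.
Proof.
move=> od; have [dE dA] := od.
have <- : [set [set a.1; a.2] | a in induced_arcs d A] = induced_edges e A.
  apply/setP=> E; rewrite inE; apply/imsetP/andP => [[[u v]]|[EA]].
    rewrite inE /= => /and3P[duv uA vA] ->; split.
      by rewrite subUset !sub1set uA.
    by apply/existsP; exists u; apply/existsP; exists v; rewrite dE duv eqxx.
  case/existsP=> u /existsP[v /andP[euv /eqP E_uv]]; rewrite E_uv in EA *.
  move: EA; rewrite subUset !sub1set => /andP[uA vA].
  move: euv; rewrite dE => /orP[duv|dvu].
    by exists (u, v); rewrite ?inE //= duv uA.
  by exists (v, u); rewrite ?inE /= ?dvu ?uA ?vA // setUC.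
rewrite card_in_imset // => -[u v] [u' v']; rewrite !inE /=.
case/and3P=> duv _ _ /and3P[duv' _ _] uv_eq.
have uv := orientation_neq od duv; have := dA u v; rewrite duv /= => ndvu.
have : u \in [set u'; v'] by rewrite -uv_eq set21.
have : v \in [set u'; v'] by rewrite -uv_eq set22.
rewrite !inE => /orP[] /eqP v_eq /orP[] /eqP u_eq.
- by rewrite u_eq v_eq eqxx in uv.
- by rewrite u_eq v_eq duv' in ndvu.
- by rewrite u_eq v_eq.
- by rewrite u_eq v_eq eqxx in uv.
Qed.

Definition prefix_set s (i : nat) : {set T} := [set x | s x <= i].

Definition odd_prefix s i := odd #|induced_edges e (prefix_set s i)|.

Definition even_labelings :=
  [set s in labelings T | [forall i : 'I_#|T|, ~~ odd_prefix s i]].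

Lemma prefix_set_index (p : #|T|.-tuple T) (i : 'I_#|T|) : uniq p ->
  prefix_set (index_labeling p) i = [set x in take i.+1 p].
Proof.
move=> p_uniq; apply/setP => x; rewrite !inE index_labelingE //.
by rewrite in_take_leq ?size_tuple.
Qed.

Lemma even_labelings_index (p : #|T|.-tuple T) : uniq p ->
  (index_labeling p \in even_labelings) = even_sequence e p.
Proof.
move=> p_uniq; rewrite inE index_labeling_labelings // /even_sequence p_uniq /=.
by apply: eq_forallb => i; rewrite /odd_prefix prefix_set_index.
Qed.

Lemma card_even_labelings : #|even_labelings| = eta e.
Proof.
rewrite /eta -(card_in_imset (f := @index_labeling T)) => [|p q]; last first.
  by rewrite !inE => /andP[p_uniq _] /andP[q_uniq _]; apply: index_labeling_inj.
apply: eq_card => s; apply/idP/imsetP => [sE|[p + ->]]; last first.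
  by rewrite inE => pE; rewrite even_labelings_index //; case/andP: pE.
have /setIdP[/labeling_index[p p_uniq sp] _] := sE.
by exists p; rewrite ?inE // -even_labelings_index // -sp.
Qed.

Definition reverse_upto (j k : 'I_#|T|) : 'I_#|T| :=
  insubd k (if k <= j then j - k else k).

Lemma val_reverse_upto j k :
  reverse_upto j k = (if k <= j then j - k else k) :> nat.
Proof.
rewrite /reverse_upto; case: ifP => _; last by rewrite valKd.
by rewrite insubdK //; apply: leq_ltn_trans (leq_subr _ _) (ltn_ord j).
Qed.

Lemma reverse_uptoK j : involutive (reverse_upto j).
Proof.
move=> k; apply/ord_inj; rewrite !val_reverse_upto.
by have [kj|kj] := leqP k j; rewrite ?leq_subr ?subKn // leqNgt kj.
Qed.

Definition reverse_prefix j s : {ffun T -> 'I_#|T|} :=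
  [ffun x => reverse_upto j (s x)].

Lemma reverse_prefixK j : involutive (reverse_prefix j).
Proof. by move=> s; apply/ffunP=> x; rewrite !ffunE reverse_uptoK. Qed.

Lemma reverse_prefix_labelings j s :
  (reverse_prefix j s \in labelings T) = (s \in labelings T).
Proof.
rewrite !inE; apply/injectiveP/injectiveP => s_inj x y; last first.
  by rewrite !ffunE => /(inv_inj (reverse_uptoK j)) /s_inj.
by move=> sxy; apply: s_inj; rewrite !ffunE sxy.
Qed.

Lemma prefix_set_reverse (j : 'I_#|T|) s i : j <= i ->
  prefix_set (reverse_prefix j s) i = prefix_set s i.
Proof.
move=> ji; apply/setP => x; rewrite !inE ffunE val_reverse_upto.
by case: ifP; lia.
Qed.

Lemma odd_prefix_reverse (j : 'I_#|T|) s i : j <= i ->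
  odd_prefix (reverse_prefix j s) i = odd_prefix s i.
Proof. by move=> ji; rewrite /odd_prefix prefix_set_reverse. Qed.

Lemma odd_des_reverse d j s : orientation e d -> s \in labelings T ->
  odd (des d (reverse_prefix j s)) = odd (des d s) (+) odd_prefix s j.
Proof.
move=> od; rewrite inE => /injectiveP s_inj.
rewrite /odd_prefix (card_induced_edges _ od).
set B := induced_arcs _ _; set D := descents d s.
set D' := descents d (reverse_prefix j s).
have out : D' :\: B = D :\: B.
  apply/setP=> -[u v]; rewrite !inE !ffunE /= !val_reverse_upto.
  case: (d u v) => //=.
  by case: (leqP (s u) j); case: (leqP (s v) j) => /=; lia.
have flipped : D' :&: B = B :\: D.
  apply/setP=> -[u v]; rewrite !inE !ffunE /= !val_reverse_upto.
  case duv: (d u v) => //=.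
  have : s u <> s v :> nat.
    by move/ord_inj/s_inj/eqP; apply/negP/(orientation_neq od duv).
  by case: (leqP (s u) j); case: (leqP (s v) j) => /=; lia.
rewrite /des -/D -/D' -(cardsID B D') -(cardsID B D) -(cardsID D B).
by rewrite out flipped (setIC D B) !oddD addbACA addbb addFb addbC.
Qed.

Definition longest_odd_prefix s : option 'I_#|T| :=
  [pick j : 'I_#|T| | odd_prefix s j &
                       [forall (k : 'I_#|T| | odd_prefix s k), k <= j]].

Lemma longest_odd_prefix_SomeP s (j : 'I_#|T|) :
  reflect (odd_prefix s j /\ forall k : 'I_#|T|, odd_prefix s k -> k <= j)
          (longest_odd_prefix s == Some j).
Proof.
rewrite /longest_odd_prefix.
case: pickP => [i /andP[si /forall_inP i_max]|none].
  apply: (iffP eqP) => [[<-] //|[sj j_max]]; congr Some.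
  by apply/ord_inj/eqP; rewrite eqn_leq j_max ?i_max.
apply: (iffP eqP) => // -[sj j_max].
by have := none j; rewrite sj /= => /forall_inP[].
Qed.

Lemma longest_odd_prefix_None s :
  (longest_odd_prefix s == None) = [forall j : 'I_#|T|, ~~ odd_prefix s j].
Proof.
apply/eqP/forallP => [none j|even_s]; last first.
  case E: longest_odd_prefix => [j|//].
  by have /eqP/longest_odd_prefix_SomeP[+ _] := E; rewrite (negbTE (even_s j)).
apply/negP => sj.
have [i si i_max] := @arg_maxnP _ j (odd_prefix s) (@nat_of_ord _) sj.
have : longest_odd_prefix s == Some i by apply/longest_odd_prefix_SomeP.
by rewrite none.
Qed.

Definition flip_odd_prefix s :=
  if longest_odd_prefix s is Some j then reverse_prefix j s else s.

Lemma longest_odd_prefix_flip s :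
  longest_odd_prefix (flip_odd_prefix s) = longest_odd_prefix s.
Proof.
rewrite /flip_odd_prefix; case E: (longest_odd_prefix s) => [j|]; last exact: E.
have /eqP/longest_odd_prefix_SomeP[sj j_max] := E.
apply/eqP/longest_odd_prefix_SomeP; split=> [|k].
  by rewrite odd_prefix_reverse.
have [//|jk] := leqP k j; rewrite odd_prefix_reverse ?(ltnW jk) // => /j_max.
by rewrite leqNgt jk.
Qed.

Lemma flip_odd_prefixK : involutive flip_odd_prefix.
Proof.
move=> s; rewrite {1}/flip_odd_prefix longest_odd_prefix_flip /flip_odd_prefix.
by case: longest_odd_prefix => // j; rewrite reverse_prefixK.
Qed.

Lemma flip_odd_prefix_labelings s :
  (flip_odd_prefix s \in labelings T) = (s \in labelings T).
Proof.
rewrite /flip_odd_prefix; case: longest_odd_prefix => // j.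
exact: reverse_prefix_labelings.
Qed.

Lemma eulerianN1 d : orientation e d ->
  (eulerian d).[-1]%R = (\sum_(s in even_labelings) (-1) ^+ des d s)%R.
Proof.
move=> od; rewrite /eulerian horner_sum; under eq_bigr do rewrite hornerXn.
rewrite (bigID (fun s => longest_odd_prefix s == None)) /=.
rewrite [X in (_ + X)%R](sumr_sign_reversing flip_odd_prefixK) ?addr0.
- by apply: eq_bigl => s; rewrite longest_odd_prefix_None [RHS]inE.
- by move=> s; rewrite flip_odd_prefix_labelings longest_odd_prefix_flip.
move=> s /andP[sL]; rewrite /flip_odd_prefix.
case E: longest_odd_prefix => [j|//] _.
have /eqP/longest_odd_prefix_SomeP[sj _] := E.
by rewrite -signr_odd odd_des_reverse // sj addbT signrN signr_odd.
Qed.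

Lemma odd_des_even_labelings d :
    symmetric e -> irreflexive e -> nu e = eta e -> orientation e d ->
  {in even_labelings &, forall s1 s2, odd (des d s1) = odd (des d s2)}.
Proof.
move=> e_sym e_irr nu_eta od; apply: (@odd_eq_of_card_le_norm_sum int).
rewrite -eulerianN1 // card_even_labelings -nu_eta (nuE e_sym e_irr od).
by rewrite natz abszE.
Qed.

End EvenLabelings.

Section EvenColorings.

Variable T : finType.
Implicit Types (e d : rel T) (g : T -> nat) (A : {set T}).

Definition in_degree d v := #|[set u | d u v]|.

Definition proper_coloring e g := forall u v, e u v -> g u != g v.

Definition acyclic_orientation e g : rel T := [rel u v | e u v && (g u < g v)].

Lemma acyclic_orientationE e g u v :
  acyclic_orientation e g u v = e u v && (g u < g v).
Proof. by []. Qed.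

(* Listing the vertices by increasing color adds an even number of edges at each
   step, so any such ordering is an even sequence. *)
Definition even_coloring e g :=
  proper_coloring e g /\
  forall v, ~~ odd (in_degree (acyclic_orientation e g) v).

Definition disagreements e g1 g2 : {set T * T} :=
  [set a | acyclic_orientation e g1 a.1 a.2 && (g2 a.2 < g2 a.1)].

Lemma acyclic_orientationP e g : symmetric e -> proper_coloring e g ->
  orientation e (acyclic_orientation e g).
Proof.
move=> e_sym g_proper; split=> u v; last first.
  by apply/negP=> /andP[/andP[_ +] /andP[_]]; case: ltngtP.
rewrite !acyclic_orientationE (e_sym v u) -andb_orr -neq_ltn.
by case: (boolP (e u v)) => // /g_proper.
Qed.

Lemma card_induced_arcs d A : (forall u v, d u v -> v \in A -> u \in A) ->
  #|induced_arcs d A| = \sum_(v in A) in_degree d v.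
Proof.
move=> A_closed; rewrite -sum1_card (partition_big snd [in A]) /=; last first.
  by move=> a; rewrite inE => /and3P[].
apply: eq_bigr => v vA; rewrite sum1_card /in_degree.
rewrite -[RHS](card_imset (f := pair^~ v)) => [|u u' []] //.
apply: eq_card => -[u w]; rewrite [LHS]unfold_in /= !inE /=.
apply/andP/imsetP => [[/andP[duw _] /eqP wv]|[u' + [-> ->]]].
  by exists u; rewrite -wv ?inE.
by rewrite inE => duv; rewrite duv vA (A_closed _ _ duv).
Qed.

Lemma even_coloring_labeling e g : symmetric e -> even_coloring e g ->
  exists2 s, s \in even_labelings e &
    forall u v, e u v -> (s u < s v) = (g u < g v).
Proof.
move=> e_sym [g_proper g_even]; have [s sL s_mono] := monotone_labeling g.
have s_g u v : e u v -> (s u < s v) = (g u < g v).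
  move=> /g_proper; case: (ltngtP (g u) (g v)) => // [/s_mono ->|/s_mono] //.
  by case: ltngtP.
exists s => //; rewrite inE sL; apply/forallP => i.
have od := acyclic_orientationP e_sym g_proper.
rewrite /odd_prefix (card_induced_edges _ od).
rewrite card_induced_arcs => [|u v /andP[_ /s_mono /ltnW uv]]; last first.
  by rewrite !inE; apply: leq_trans uv.
by elim/big_ind: _ => // m n; rewrite oddD => /negbTE ->.
Qed.

Lemma even_disagreements e g1 g2 :
    symmetric e -> irreflexive e -> nu e = eta e ->
    even_coloring e g1 -> even_coloring e g2 ->
  ~~ odd #|disagreements e g1 g2|.
Proof.
move=> e_sym e_irr nu_eta g1_even g2_even.
have [s1 s1E s1_g] := even_coloring_labeling e_sym g1_even.
have [s2 s2E s2_g] := even_coloring_labeling e_sym g2_even.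
have [g1_proper _] := g1_even.
have od := acyclic_orientationP e_sym g1_proper.
have des1 : des (acyclic_orientation e g1) s1 = 0.
  apply: eq_card0 => -[u v]; rewrite !inE /= -andbA.
  case: (boolP (e u v)) => //=.
  by rewrite e_sym => /s1_g ->; case: ltngtP.
have <- : des (acyclic_orientation e g1) s2 = #|disagreements e g1 g2|.
  apply: eq_card => -[u v]; rewrite !inE /= -!andbA.
  case: (boolP (e u v)) => //=.
  by rewrite e_sym => /s2_g ->.
by rewrite -(odd_des_even_labelings e_sym e_irr nu_eta od s1E s2E) des1.
Qed.

Lemma eq_even_coloring e e' g : e =2 e' ->
  even_coloring e g -> even_coloring e' g.
Proof.
move=> ee' [g_proper g_even]; split=> [u v|v].
  by rewrite -ee'; apply: g_proper.
have := g_even v; congr (~~ odd _); apply: eq_card => u.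
by rewrite !inE !acyclic_orientationE ee'.
Qed.

Lemma eq_disagreements e e' g1 g2 : e =2 e' ->
  disagreements e g1 g2 = disagreements e' g1 g2.
Proof.
by move=> ee'; apply/setP => a; rewrite !inE !acyclic_orientationE ee'.
Qed.

End EvenColorings.

Section Bijections.

Variables (S T : finType) (f : S -> T).
Implicit Types (e : rel T) (g : T -> nat).

Lemma even_coloring_relpre e g : bijective f ->
  even_coloring e g -> even_coloring (relpre f e) (g \o f).
Proof.
move=> f_bij [g_proper g_even]; split=> [u v /g_proper //|v].
have <- : in_degree (acyclic_orientation e g) (f v) =
          in_degree (acyclic_orientation (relpre f e) (g \o f)) v.
  rewrite -[LHS](on_card_preimset (onW_bij _ f_bij)).
  by apply: eq_card => u; rewrite !inE.
exact: g_even.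
Qed.

Lemma card_disagreements_relpre e g1 g2 : bijective f ->
  #|disagreements (relpre f e) (g1 \o f) (g2 \o f)| = #|disagreements e g1 g2|.
Proof.
case=> f' fK f'K; pose f2 (a : S * S) := (f a.1, f a.2).
have f2_bij : bijective f2.
  by exists (fun a => (f' a.1, f' a.2)) => -[u v]; rewrite /f2 /= ?fK ?f'K.
rewrite -[RHS](on_card_preimset (onW_bij _ f2_bij)).
by apply: eq_card => a; rewrite !inE.
Qed.

End Bijections.

Section Embeddings.

Variables (S T : finType) (f : S -> T).

Lemma imset_sub_bij : injective f ->
  exists2 h : {x | x \in f @: setT} -> S,
    bijective h & forall u, f (h u) = val u.
Proof.
move=> f_inj; have fA x : f x \in f @: setT by rewrite imset_f.
pose F x : {y | y \in f @: setT} := Sub (f x) (fA x).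
have F_inj : injective F by move=> x y /(congr1 val) /f_inj.
have [|h FK hK] := inj_card_bij F_inj.
  by rewrite card_sig (eq_card (_ : _ =i f @: setT)) // card_imset // cardsT.
by exists h => [|u]; [exists F | rewrite -{2}(hK u)].
Qed.

Lemma even_disagreements_embedding e (g1 g2 : S -> nat) :
    symmetric e -> irreflexive e ->
    (forall A, nu (induced e A) = eta (induced e A)) -> injective f ->
    even_coloring (relpre f e) g1 -> even_coloring (relpre f e) g2 ->
  ~~ odd #|disagreements (relpre f e) g1 g2|.
Proof.
move=> e_sym e_irr nu_eta /imset_sub_bij[h h_bij fh] g1_even g2_even.
have eE : relpre h (relpre f e) =2 induced e (f @: setT).
  by move=> u v; rewrite /= !fh.
have h_even g : even_coloring (relpre f e) g ->
    even_coloring (induced e (f @: setT)) (g \o h).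
  by move=> /(even_coloring_relpre h_bij); apply: eq_even_coloring.
rewrite -(card_disagreements_relpre _ _ _ h_bij) (eq_disagreements _ _ eE).
apply: even_disagreements (nu_eta _) (h_even _ g1_even) (h_even _ g2_even).
  by move=> u v; apply: e_sym.
by move=> u; apply: e_irr.
Qed.

End Embeddings.

Section Walks.

Variables (T : finType) (e : rel T).
Hypothesis e_sym : symmetric e.

Definition walk k u v := [exists p : k.-tuple T, path e u p && (last u p == v)].

Lemma walkP k u v :
  reflect (exists2 p, path e u p & size p = k /\ last u p = v) (walk k u v).
Proof.
apply: (iffP existsP) => [[p /andP[up /eqP <-]]|[p up [pk pv]]].
  by exists p; rewrite ?size_tuple.
by rewrite -pk; exists (in_tuple p); rewrite up pv /=.
Qed.

Lemma walk0 u v : walk 0 u v = (u == v).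
Proof.
apply/walkP/eqP => [[p _ [/size0nil -> //]]|<-].
by exists [::].
Qed.

Lemma walk1 u v : walk 1 u v = e u v.
Proof.
apply/walkP/idP => [[p + []]|uv].
  by case: p => [|x []] //=; rewrite andbT => + _ <-.
by exists [:: v]; rewrite //= uv.
Qed.

Lemma walk_cat j k u v w : walk j u v -> walk k v w -> walk (j + k) u w.
Proof.
move=> /walkP[p up [<- pv]] /walkP[q vq [<- <-]]; apply/walkP.
by exists (p ++ q); rewrite ?size_cat ?last_cat ?cat_path ?pv ?up.
Qed.

Lemma walk_sym k u v : walk k u v -> walk k v u.
Proof.
move=> /walkP[p up [<- <-]]; apply/walkP; exists (rev (belast u p)).
  by rewrite rev_path (eq_path (e' := e)) // => x y; apply: e_sym.
split; first by rewrite size_rev size_belast.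
by case: p {up} => //= x p; rewrite rev_cons last_rcons.
Qed.

Definition odd_closed_walk k := odd k && [exists u, walk k u u].

Lemma bipartite_or_odd_closed_walk : connected_graph e ->
  bipartite e \/ exists k, odd_closed_walk k.
Proof.
move=> e_conn; have [r _|T0] := pickP T; last first.
  by left; exists set0 => u; have := T0 u.
have reach v : exists k, walk k r v.
  have /connectP[p rp ->] := e_conn r v.
  by exists (size p); apply/walkP; exists p.
pose depth v := xchoose (reach v).
have depthP v : walk (depth v) r v := xchooseP (reach v).
have [/existsP[u /existsP[v /andP[euv /eqP uv]]]|none] :=
    boolP [exists u, exists v, e u v && (odd (depth u) == odd (depth v))].
  right; exists (depth u + (1 + depth v)).
  rewrite /odd_closed_walk !oddD uv addbCA addbb; apply/existsP; exists r.
  apply: walk_cat (depthP u) _.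
  by apply: walk_cat (walk_sym (depthP v)); rewrite walk1.
left; exists [set v | odd (depth v)] => u v euv; rewrite !inE.
apply: contraNneq none => uv; apply/existsP; exists u; apply/existsP; exists v.
by rewrite euv uv eqxx.
Qed.

End Walks.

Lemma addr_neq (V : zmodType) (x y : V) : (y != 0 -> x + y != x)%R.
Proof. by rewrite -{2}[x]addr0 (inj_eq (addrI x)). Qed.

Section CyclicOrdinals.

Variable m : nat.
Local Notation n := m.+3.
Implicit Types (i j : 'I_n) (k d : nat).
Local Open Scope ring_scope.

Lemma natr_ord_eq0 k : (k%:R == 0 :> 'I_n) = (n %| k)%N.
Proof. by rewrite -(inj_eq val_inj) /= (@val_Zp_nat n). Qed.

Lemma ord_two_neq0 : 2 != 0 :> 'I_n.
Proof. by rewrite natr_ord_eq0 gtnNdvd. Qed.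

Lemma natr_ordN k d : (k + d = n)%N -> k%:R = - d%:R :> 'I_n.
Proof.
by move=> kd; apply/eqP; rewrite -addr_eq0 -natrD natr_ord_eq0 kd dvdnn.
Qed.

Lemma ord_offset i j : exists2 d, (d < n)%N & j = i + d%:R.
Proof. by exists (j - i : 'I_n) => //; rewrite natr_Zp subrKC. Qed.

Lemma ordSE i : ordS i = i + 1.
Proof. by apply/val_inj; rewrite /= addn1. Qed.

Lemma val_ordD1 i : (i + 1)%R = (if i == m.+2 :> nat then 0 else i.+1)%N :> nat.
Proof.
rewrite /= addn1; have [->|i_neq] := eqVneq (i : nat) m.+2.
  by rewrite modnn.
by rewrite modn_small // ltn_neqAle eqSS i_neq ltn_ord.
Qed.

Lemma ordD1_eq0 i : (i + 1 == 0) = (i == m.+2 :> nat).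
Proof. by rewrite -[LHS]/((i + 1)%R == 0%N :> nat) val_ordD1; case: ifP. Qed.

Lemma odd_ordD1 i : odd (i + 1)%R = ~~ odd i && (i + 1 != 0).
Proof. by rewrite ordD1_eq0 val_ordD1; case: ifP; rewrite ?andbF ?andbT. Qed.

Lemma ord_sub1_neq_add1 i : i - 1 != i + 1.
Proof.
rewrite -subr_eq0 (_ : _ - _ = - 2) ?oppr_eq0; last by ring.
exact: ord_two_neq0.
Qed.

Hypothesis n_odd : odd n.

Lemma ord_add4_neq i : (0 < m)%N ->
  [/\ i + 4 != i, i + 4 != i + 2 & i + 4 != i - 2].
Proof.
move=> m_gt0; split; rewrite -subr_eq0.
- rewrite (_ : _ - _ = 4); last by ring.
  by rewrite natr_ord_eq0 gtnNdvd //; lia.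
- by rewrite (_ : _ - _ = 2) ?ord_two_neq0 //; ring.
rewrite (_ : _ - _ = 6); last by ring.
rewrite natr_ord_eq0; apply/negP => n6.
have n_le6 := dvdn_leq (isT : 0 < 6)%N n6.
have n5 : n = 5 by lia.
by rewrite n5 in n6.
Qed.

Lemma odd_ordD1_neq0 i : odd i -> i + 1 != 0.
Proof.
by apply: contraL; rewrite ordD1_eq0 => /eqP ->; move: n_odd; rewrite /= negbK.
Qed.

Lemma odd_ordN i : odd (- i)%R = (i != 0) && ~~ odd i.
Proof.
have [->|i_neq0] := eqVneq i 0; first by rewrite oppr0.
have -> : (- i)%R = (n - i)%N :> nat.
  by rewrite /= modn_small // ltn_subrL lt0n i_neq0.
by rewrite oddB ?n_odd // ltnW.
Qed.

Lemma odd_ordND1 i : odd (- (i + 1))%R = odd i.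
Proof.
rewrite odd_ordN odd_ordD1.
by have := @odd_ordD1_neq0 i; case: (i + 1 == 0); case: (odd i) => // /(_ isT).
Qed.

Lemma odd_ordB1 i : odd (i - 1)%R = (i != 0) && ~~ odd i.
Proof.
have := odd_ordD1 (i - 1); have := @odd_ordD1_neq0 (i - 1); rewrite subrK.
by move=> + ->; case: (i == 0); case: (odd (i - 1)%R) => // /(_ isT).
Qed.

End CyclicOrdinals.

Section ShortestOddCycles.

Variables (T : finType) (e : rel T).
Hypotheses (e_sym : symmetric e) (e_irr : irreflexive e).
Local Open Scope ring_scope.

Definition edge_cycle m (c : 'I_m.+3 -> T) := forall i, e (c i) (c (i + 1)).

Definition shortest_odd_cycle m (c : 'I_m.+3 -> T) :=
  [/\ odd m.+3, edge_cycle c & forall k, odd_closed_walk e k -> (m.+3 <= k)%N].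

Lemma exists_shortest_odd_cycle k : odd_closed_walk e k ->
  exists m (c : 'I_m.+3 -> T), shortest_odd_cycle c.
Proof.
move=> odd_k; have [] := @ex_minnP (odd_closed_walk e); first by exists k.
case=> [|[|[|m]]] //.
  by case/andP=> _ /existsP[u]; rewrite walk1 e_irr.
case/andP=> m_odd /existsP[u /walkP[p up [pm pu]]] min_m.
exists m, (fun i => nth u (u :: p) i); split=> // i.
have e_nth l : (l < m.+3)%N -> e (nth u (u :: p) l) (nth u (u :: p) l.+1).
  by rewrite -pm => lp; have /(pathP u)/(_ l lp) := up.
rewrite val_ordD1; case: eqP => [->|_]; last exact: e_nth.
have last_p : nth u p m.+2 = u by rewrite -[m.+2]/(m.+3.-1) -pm nth_last pu.
by have := e_nth m.+2 (ltnSn _); rewrite [in X in _ X]/= last_p.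
Qed.

Variable m : nat.
Local Notation n := m.+3.
Implicit Types (c : 'I_n -> T) (i j : 'I_n).

Lemma walk_along_cycle c i d : edge_cycle c -> walk e d (c i) (c (i + d%:R)).
Proof.
move=> cE; elim: d => [|d IHd]; first by rewrite addr0 walk0.
by rewrite -addn1 natrD addrA; apply: walk_cat IHd _; rewrite walk1.
Qed.

Lemma leq_odd_closed_walk c k u : shortest_odd_cycle c ->
  odd k -> walk e k u u -> (n <= k)%N.
Proof.
case=> _ _ n_min odd_k uu; apply: n_min; rewrite /odd_closed_walk odd_k.
by apply/existsP; exists u.
Qed.

(* A walk between two vertices of [c] closes up with either arc between them;
   the arc of the other parity gives an odd closed walk. *)
Lemma leq_arc_walk c i d k : shortest_odd_cycle c -> (d <= n)%N ->
    walk e k (c i) (c (i + d%:R)) ->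
  ((if odd (d + k) then n - d else d) <= k)%N.
Proof.
move=> c_min dn ik; have [n_odd cE _] := c_min; case: ifP => odd_dk.
  rewrite leq_subLR; apply: (leq_odd_closed_walk (u := c i) c_min) => //.
  exact: walk_cat (walk_along_cycle i d cE) (walk_sym e_sym ik).
have back : walk e (n - d) (c (i + d%:R)) (c i).
  have := walk_along_cycle (i + d%:R) (n - d) cE.
  by rewrite (natr_ordN (subnK dn)) addrK.
have := leq_odd_closed_walk c_min _ (walk_cat back ik); lia.
Qed.

Lemma shortest_odd_cycle_inj c : shortest_odd_cycle c -> injective c.
Proof.
move=> c_min i j; have [d dn ->] := ord_offset i j => cij.
have : walk e 0 (c i) (c (i + d%:R)) by rewrite walk0 cij.
move/(leq_arc_walk c_min (ltnW dn)); rewrite addn0; case: ifP => _.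
  by lia.
by rewrite leqn0 => /eqP ->; rewrite addr0.
Qed.

Lemma shortest_odd_cycle_adj c i j : shortest_odd_cycle c ->
  e (c i) (c j) = (j == i + 1) || (i == j + 1).
Proof.
move=> c_min; have [n_odd cE _] := c_min.
apply/idP/orP => [|[/eqP ->|/eqP ->] //]; last by rewrite e_sym.
have [d dn ->] := ord_offset i j; rewrite -walk1.
move/(leq_arc_walk c_min (ltnW dn)); case: ifP => odd_d d_le; [right | left].
  by rewrite (@natr_ordN _ d 1) ?subrK //; lia.
by have -> : d = 1%N by lia.
Qed.

Lemma common_neighbor c i j v : shortest_odd_cycle c ->
  e v (c i) -> e v (c j) -> [\/ j = i, j = i + 2 | j = i - 2].
Proof.
move=> c_min vi; have [n_odd _ _] := c_min.
have [d dn ->] := ord_offset i j => vj.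
have : walk e 2 (c i) (c (i + d%:R)).
  by apply: (@walk_cat _ _ 1 1 _ v); rewrite walk1 // e_sym.
move/(leq_arc_walk c_min (ltnW dn)); case: ifP => odd_d d_le.
  by constructor 3; rewrite (@natr_ordN _ d 2) //; lia.
have [->|->] : d = 0%N \/ d = 2%N by lia.
  by constructor 1; rewrite addr0.
by constructor 2.
Qed.

Definition twin c j v := e v (c (j - 1)) && e v (c (j + 1)).

Definition replace c j v : 'I_n -> T := [eta c with j |-> v].

Lemma replace_id c j v : replace c j v j = v.
Proof. by rewrite /replace /= eqxx. Qed.

Lemma replace_neq c i j v : i != j -> replace c j v i = c i.
Proof. by rewrite /replace /= => /negbTE ->. Qed.

Lemma twin_cycle c j : edge_cycle c -> twin c j (c j).
Proof. by move=> cE; rewrite /twin cE andbT e_sym -{2}(subrK 1 j) cE. Qed.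

Lemma replace_shortest c j v : shortest_odd_cycle c -> twin c j v ->
  shortest_odd_cycle (replace c j v).
Proof.
move=> [n_odd cE n_min] /andP[v_pred v_succ]; split=> // i.
have [->|ij] := eqVneq i j.
  by rewrite replace_id replace_neq // addr_neq // oner_neq0.
rewrite (replace_neq _ _ ij).
have [iSj|/replace_neq -> //] := eqVneq (i + 1) j.
by rewrite iSj replace_id e_sym -[i](addrK 1) iSj.
Qed.

End ShortestOddCycles.

Section PendantCycle.

Variable m : nat.
Local Notation n := m.+3.
Hypothesis n_odd : odd n.
Implicit Types (i j : 'I_n) (x y : option 'I_n).
Local Open Scope ring_scope.

(* [None] is the pendant vertex, attached to the cycle at [0]. *)
Definition pendant_cycle : rel (option 'I_n) := fun x y =>
  match x, y with
  | Some i, Some j => (j == i + 1) || (i == j + 1)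
  | Some i, None | None, Some i => i == 0
  | None, None => false
  end.

(* Along the cycle the colors read 1, 2, 0, 2, 0, ..., 2, 0. *)
Definition pendant_coloring x : nat :=
  if x is Some i then if i == 0 then 1 else (odd i).*2 else 0.

Definition mirror x := omap -%R x.

Lemma mirrorK : involutive mirror.
Proof. by case=> //= i; rewrite opprK. Qed.

Lemma pendant_cycle_mirror x y :
  pendant_cycle (mirror x) (mirror y) = pendant_cycle x y.
Proof.
case: x y => [i|] [j|] //=; try by rewrite oppr_eq0.
have negS i' j' : (- j' == - i' + 1) = (i' == j' + 1).
  by rewrite -subr_eq0 -[RHS]subr_eq0; congr (_ == _); ring.
by rewrite !negS orbC.
Qed.

Lemma pendant_coloring_ltS i :
  (pendant_coloring (Some i) < pendant_coloring (Some (i + 1)%R))%N = ~~ odd i.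
Proof.
rewrite /= odd_ordD1; have [->|i_neq0] := eqVneq i 0; first by rewrite add0r.
by have [_|_] := eqVneq (i + 1) 0; case: (odd i).
Qed.

Lemma pendant_coloring_gtS i :
  (pendant_coloring (Some (i + 1)%R) < pendant_coloring (Some i))%N = odd i.
Proof.
rewrite /= odd_ordD1; have [->|i_neq0] := eqVneq i 0; first by rewrite add0r.
have [iS|_] := eqVneq (i + 1) 0; last by case: (odd i).
by have := @odd_ordD1_neq0 _ n_odd i; rewrite iS; case: (odd i) => // /(_ isT).
Qed.

Lemma mirrorS i : mirror (Some i) = Some (- (i + 1) + 1).
Proof. by rewrite opprD subrK. Qed.

Lemma pendant_coloring_mirror_ltS i :
  (pendant_coloring (mirror (Some i)) <
   pendant_coloring (mirror (Some (i + 1)%R)))%N = odd i.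
Proof. by rewrite mirrorS pendant_coloring_gtS (odd_ordND1 n_odd). Qed.

Lemma pendant_coloring_mirror_gtS i :
  (pendant_coloring (mirror (Some (i + 1)%R)) <
   pendant_coloring (mirror (Some i)))%N = ~~ odd i.
Proof. by rewrite (mirrorS i) pendant_coloring_ltS (odd_ordND1 n_odd). Qed.

Lemma pendant_coloring_proper : proper_coloring pendant_cycle pendant_coloring.
Proof.
have neqS i : pendant_coloring (Some i) != pendant_coloring (Some (i + 1)).
  by rewrite neq_ltn pendant_coloring_ltS pendant_coloring_gtS orNb.
case=> [i|] [j|] //; last by move=> /eqP ->.
- by case/orP=> /eqP ->; rewrite // eq_sym.
- by move=> /eqP ->.
Qed.

Lemma pendant_cycle_SomeE i j :
  pendant_cycle (Some i) (Some j) = (i == j - 1) || (i == j + 1).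
Proof. by rewrite /pendant_cycle [i == j - 1]eq_sym subr_eq. Qed.

Lemma pendant_orientation_SomeE i j :
  acyclic_orientation pendant_cycle pendant_coloring (Some i) (Some j) =
  (i == j - 1) && ((j == 0) || odd j) || (i == j + 1) && odd j.
Proof.
rewrite acyclic_orientationE pendant_cycle_SomeE andb_orl; congr (_ || _).
  have [->|//] := eqVneq i (j - 1).
  rewrite -{2}(subrK 1 j) pendant_coloring_ltS.
  by rewrite (odd_ordB1 n_odd) negb_and !negbK.
by have [->|//] := eqVneq i (j + 1); rewrite pendant_coloring_gtS.
Qed.

Lemma pendant_coloring_in_neighbors j :
  [set x | acyclic_orientation pendant_cycle pendant_coloring x (Some j)] =
  if j == 0 then [set None; Some (j - 1)]
  else if odd j then [set Some (j - 1); Some (j + 1)] else set0.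
Proof.
apply/setP => -[i|]; rewrite inE.
  rewrite pendant_orientation_SomeE; have [->|_] := eqVneq j 0.
    by rewrite !inE andbT andbF orbF.
  by case: (odd j); rewrite !inE ?andbT ?andbF.
rewrite acyclic_orientationE /=; have [->|_] := eqVneq j 0.
  by rewrite !inE.
by case: (odd j); rewrite !inE.
Qed.

Lemma pendant_coloring_even : even_coloring pendant_cycle pendant_coloring.
Proof.
split; first exact: pendant_coloring_proper.
case=> [j|]; rewrite /in_degree; last first.
  by rewrite eq_card0 // => x; rewrite inE acyclic_orientationE ltn0 andbF.
rewrite pendant_coloring_in_neighbors; case: ifP => _; first by rewrite cards2.
case: ifP => _; last by rewrite cards0.
by rewrite cards2 (inj_eq Some_inj) ord_sub1_neq_add1.
Qed.

Lemma pendant_coloring_mirror_even :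
  even_coloring pendant_cycle (pendant_coloring \o mirror).
Proof.
apply: (eq_even_coloring pendant_cycle_mirror).
exact: even_coloring_relpre (inv_bij mirrorK) pendant_coloring_even.
Qed.

Definition ascending_edge i : option 'I_n * option 'I_n :=
  if odd i then (Some (i + 1), Some i) else (Some i, Some (i + 1)).

Lemma ascending_edge_inj : injective ascending_edge.
Proof.
move=> i j; rewrite /ascending_edge.
case: (odd i); case: (odd j) => -[] // ij ji.
  by have := ord_sub1_neq_add1 j; rewrite -ji -ij addrK eqxx.
by have := ord_sub1_neq_add1 i; rewrite ji ij addrK eqxx.
Qed.

Lemma disagreements_mirror :
  disagreements pendant_cycle pendant_coloring (pendant_coloring \o mirror) =
  ascending_edge @: setT.
Proof.
apply/setP => -[x y]; rewrite inE acyclic_orientationE -andbA.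
apply/and3P/imsetP => [[xy lt_xy lt_yx]|[i _]]; last first.
  rewrite /ascending_edge; case: ifP => odd_i [-> ->]; split;
    rewrite ?[(_ \o _) _]/= ?pendant_coloring_ltS ?pendant_coloring_gtS
            ?pendant_coloring_mirror_ltS ?pendant_coloring_mirror_gtS ?odd_i //
            /pendant_cycle /= eqxx ?orbT //.
case: x y xy lt_xy lt_yx => [i|] [j|] //.
case/orP=> /eqP ->; rewrite ?pendant_coloring_ltS ?pendant_coloring_gtS.
  by move=> even_i _; exists i; rewrite // /ascending_edge (negbTE even_i).
by move=> odd_j _; exists j; rewrite // /ascending_edge odd_j.
Qed.

Lemma odd_disagreements_mirror :
  odd #|disagreements pendant_cycle pendant_coloring
          (pendant_coloring \o mirror)|.
Proof.
rewrite disagreements_mirror (card_imset _ ascending_edge_inj).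
by rewrite cardsT card_ord.
Qed.

End PendantCycle.

Lemma vertex_partition_of_partition (T : finType) (P : {set {set T}}) :
  partition P setT -> vertex_partition (fun i : 'I_#|P| => enum_val i).
Proof.
case/and3P=> /eqP P_cover P_disjoint P_nonempty; split=> [i|u].
  by apply: contraNneq P_nonempty => <-; apply: enum_valP.
have uP : pblock P u \in P by rewrite pblock_mem // P_cover inE.
exists (enum_rank_in uP (pblock P u)); split=> [|i ui].
  by rewrite enum_rankK_in // mem_pblock P_cover inE.
apply/enum_val_inj; rewrite enum_rankK_in //.
by apply: def_pblock ui; rewrite ?enum_valP.
Qed.

Lemma complete_multipartite_of_cotransitive (T : finType) (e : rel T) :
    symmetric e -> irreflexive e -> (forall x y z, e x z -> e x y || e y z) ->
  complete_multipartite e.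
Proof.
move=> e_sym e_irr e_cotrans; pose nonadj := [rel x y | ~~ e x y].
have nonadj_equiv : {in setT & &, equivalence_rel nonadj}.
  move=> x y z _ _ _; split=> [|nxy]; first by rewrite /= e_irr.
  congr (~~ _); apply/idP/idP => [/(e_cotrans x y)|/(e_cotrans y x)].
    by rewrite (negbTE nxy).
  by rewrite e_sym (negbTE nxy).
pose P := equivalence_partition nonadj setT.
have P_part : partition P setT := equivalence_partitionP nonadj_equiv.
have [_ P_disjoint _] := and3P P_part.
exists #|P|, (fun i => enum_val i); split.
  exact: vertex_partition_of_partition.
have blockP (u : T) (i : 'I_#|P|) : u \in enum_val i -> enum_val i = pblock P u.
  by move=> ui; rewrite (def_pblock P_disjoint (enum_valP i) ui).
have adjE u v : e u v = (pblock P u != pblock P v).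
  rewrite eq_pblock ?(cover_partition P_part) ?inE //.
  by rewrite (pblock_equivalence_partition nonadj_equiv) ?inE //= negbK.
have [_ some_block] := vertex_partition_of_partition P_part.
move=> u v; split=> [|[i [j [ij /blockP ui /blockP vj]]]]; last first.
  by rewrite adjE -ui -vj (inj_eq enum_val_inj).
have [[i [ui _]] [j [vj _]]] := (some_block u, some_block v).
rewrite adjE -(blockP _ _ ui) -(blockP _ _ vj) (inj_eq enum_val_inj).
by exists i, j.
Qed.

Section Classification.

Variables (T : finType) (e : rel T).
Hypotheses (e_sym : symmetric e) (e_irr : irreflexive e).
Hypothesis e_conn : connected_graph e.
Hypothesis nu_eta : forall A : {set T}, nu (induced e A) = eta (induced e A).
Local Open Scope ring_scope.

Section Twins.

Variable m : nat.
Local Notation n := m.+3.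
Implicit Types (c : 'I_n -> T) (i j : 'I_n) (u v : T).

Lemma no_pendant_at0 c v : shortest_odd_cycle e c ->
  ~ (forall j, e v (c j) = (j == 0)).
Proof.
move=> c_min v_pendant; have [n_odd cE _] := c_min.
pose f (x : option 'I_n) := if x is Some i then c i else v.
have fE : relpre f e =2 @pendant_cycle m.
  case=> [i|] [j|] /=; last exact: e_irr.
  - exact: (shortest_odd_cycle_adj e_sym _ _ c_min).
  - by rewrite e_sym.
  - exact: v_pendant.
have c_neq_v i : c i != v.
  apply/eqP => civ; have := v_pendant (i + 1); have := v_pendant (i - 1).
  rewrite -civ cE e_sym -{2}(subrK 1 i) cE => /esym/eqP pred0 /esym/eqP succ0.
  by have := ord_sub1_neq_add1 i; rewrite pred0 succ0 eqxx.
have f_inj : injective f.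
  case=> [i|] [j|] //=.
  - by move/(shortest_odd_cycle_inj e_sym c_min) ->.
  - by move/eqP; rewrite (negbTE (c_neq_v i)).
  - by move/esym/eqP; rewrite (negbTE (c_neq_v j)).
have Ef x y := esym (fE x y).
have := even_disagreements_embedding e_sym e_irr nu_eta f_inj
  (eq_even_coloring Ef (pendant_coloring_even n_odd))
  (eq_even_coloring Ef (pendant_coloring_mirror_even n_odd)).
by rewrite (eq_disagreements _ _ fE) odd_disagreements_mirror.
Qed.

Lemma no_pendant_vertex c i v : shortest_odd_cycle e c ->
  ~ (forall j, e v (c j) = (j == i)).
Proof.
move=> [n_odd cE n_min] v_pendant.
have shifted_min : shortest_odd_cycle e (fun j => c (i + j)).
  by split=> // j; rewrite addrA; apply: cE.
apply: (no_pendant_at0 (v := v) shifted_min) => j.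
by rewrite v_pendant -{2}[i]addr0 (inj_eq (addrI i)).
Qed.

Lemma neighbor_twin c i v : shortest_odd_cycle e c -> e v (c i) ->
  twin e c (i + 1) v \/ twin e c (i - 1) v.
Proof.
move=> c_min vi; rewrite /twin addrK subrK vi andbT /=.
rewrite (_ : i + 1 + 1 = i + 2); last by ring.
rewrite (_ : i - 1 - 1 = i - 2); last by ring.
apply/orP/norP => -[/negP v_add2 /negP v_sub2].
apply: (no_pendant_vertex (i := i) (v := v) c_min) => j.
apply/idP/eqP => [vj|-> //].
by have [//|ji|ji] := common_neighbor e_sym c_min vi vj; rewrite ji in vj.
Qed.

Lemma exists_twin c v : shortest_odd_cycle e c ->
  exists j, twin e c j v.
Proof.
move=> c_min; have [_ cE _] := c_min.
have /connectP[p cp ->] := e_conn (c 0) v.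
have : exists j, twin e c j (c 0) by exists 0; apply: twin_cycle.
elim: p (c 0) cp => //= w p IHp u /andP[euw wp] [j uj]; apply: (IHp w wp).
suff [i wi] : exists i, e w (c i).
  by have [|] := neighbor_twin c_min wi; eexists; eassumption.
have two_neq0 := ord_two_neq0 m.
have wj : e w (replace c j u j) by rewrite replace_id e_sym.
have [] := neighbor_twin (replace_shortest e_sym c_min uj) wj.
  case/andP=> _; rewrite replace_neq; first by exists (j + 1 + 1).
  by rewrite -addrA addr_neq.
case/andP=> + _; rewrite replace_neq; first by exists (j - 1 - 1).
by rewrite -addrA addr_neq // -opprD oppr_eq0.
Qed.

Lemma edge_on_shortest_odd_cycle c x z :
    shortest_odd_cycle e c -> e x z ->
  exists (d : 'I_n -> T) i, shortest_odd_cycle e d /\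
    ((d i = x /\ d (i + 1) = z) \/ (d i = z /\ d (i + 1) = x)).
Proof.
move=> c_min xz; have [i xi] := exists_twin x c_min.
pose c' := replace c i x.
have c'_min : shortest_odd_cycle e c' := replace_shortest e_sym c_min xi.
have zi : e z (c' i) by rewrite /c' replace_id e_sym.
have one_neq0 := oner_neq0 'I_n.
have [] := neighbor_twin c'_min zi => /(replace_shortest e_sym c'_min) d_min.
  exists (replace c' (i + 1) z), i; split=> //; left.
  by rewrite replace_id replace_neq /c' ?replace_id // eq_sym addr_neq.
exists (replace c' (i - 1) z), (i - 1); split=> //; right.
rewrite subrK replace_id replace_neq /c' ?replace_id //.
by rewrite eq_sym addr_neq ?oppr_eq0.
Qed.

End Twins.

Lemma complete_multipartite_of_triangle (c : 'I_3 -> T) :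
  shortest_odd_cycle e c -> complete_multipartite e.
Proof.
move=> c_min; apply: complete_multipartite_of_cotransitive => // x y z xz.
have [d [i [d_min xz_edge]]] := edge_on_shortest_odd_cycle c_min xz.
have [k /andP[y_pred y_succ]] := exists_twin y d_min.
suff : e y (d i) || e y (d (i + 1)).
  by case: xz_edge => -[-> ->]; rewrite [e x y]e_sym // orbC.
have : [|| i == k, i == k - 1 | i == k + 1].
  by move: i k {y_pred y_succ xz_edge} => [[|[|[]]]] // ? [[|[|[]]]].
by case/or3P=> /eqP ->; rewrite ?y_pred ?y_succ ?orbT.
Qed.

Section Blowup.

Variable m : nat.
Hypothesis m_gt0 : (0 < m)%N.
Local Notation n := m.+3.
Implicit Types (c : 'I_n -> T) (i j : 'I_n) (u v : T).

Lemma twin_cycle_neighbors c i j v : shortest_odd_cycle e c -> twin e c j v ->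
  e v (c i) = (i == j - 1) || (i == j + 1).
Proof.
move=> c_min /andP[v_pred v_succ]; have [n_odd _ _] := c_min.
apply/idP/orP => [vi|[/eqP -> //|/eqP -> //]].
have [->|->|i_sub3] := common_neighbor e_sym c_min v_pred vi; first by left.
  by right; apply/eqP; ring.
have j_succ : j + 1 = i + 4 by rewrite i_sub3; ring.
rewrite j_succ in v_succ.
have [add4 add4_2 add4_N2] := ord_add4_neq n_odd i m_gt0.
by have [] := common_neighbor e_sym c_min vi v_succ => /eqP;
  rewrite ?(negbTE add4) ?(negbTE add4_2) ?(negbTE add4_N2).
Qed.

Lemma twin_unique c i j v : shortest_odd_cycle e c ->
  twin e c i v -> twin e c j v -> i = j.
Proof.
move=> c_min vi /andP[v_pred v_succ]; have [n_odd _ _] := c_min.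
move: v_pred v_succ; rewrite !(twin_cycle_neighbors _ c_min vi).
case/orP=> [/eqP/addIr //|/eqP j_pred] /orP[]/eqP j_succ.
  have [/eqP[]] := ord_add4_neq n_odd (i - 1) m_gt0.
  transitivity (i + 1 + 2); first by ring.
  by rewrite -j_pred -j_succ; ring.
by have := ord_sub1_neq_add1 j; rewrite j_pred j_succ eqxx.
Qed.

Lemma twin_adj c i j u v : shortest_odd_cycle e c ->
    twin e c i u -> twin e c j v -> e u v ->
  j = i + 1 \/ i = j + 1.
Proof.
move=> c_min ui /andP[v_pred v_succ] uv.
have [ji|ji] := eqVneq (j - 1) i; first by left; rewrite -ji subrK.
have [ij|ij] := eqVneq (j + 1) i; first by right.
have c'_min := replace_shortest e_sym c_min ui.
have vj : twin e (replace c i u) j v by rewrite /twin !replace_neq // v_pred.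
have := twin_cycle_neighbors i c'_min vj.
rewrite replace_id e_sym uv => /esym/orP[]/eqP i_eq.
  by rewrite i_eq eqxx in ji.
by rewrite i_eq eqxx in ij.
Qed.

Lemma twin_succ_adj c i u v : shortest_odd_cycle e c ->
  twin e c i u -> twin e c (i + 1) v -> e u v.
Proof.
move=> c_min ui v_twin; have [n_odd _ _] := c_min.
have c'_min := replace_shortest e_sym c_min ui.
have v_add2 : e v (replace c i u (i + 1 + 1)).
  rewrite replace_neq; first by case/andP: v_twin.
  by rewrite -addrA addr_neq // (ord_two_neq0 m).
have [/andP[_]|/andP[+ _]] := neighbor_twin c'_min v_add2; last first.
  by rewrite !addrK replace_id e_sym.
have -> : i + 1 + 1 + 1 + 1 = i + 4 by ring.
have [add4 add4_2 _] := ord_add4_neq n_odd i m_gt0.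
rewrite replace_neq // (twin_cycle_neighbors _ c_min v_twin).
by rewrite addrK (negbTE add4) -addrA (negbTE add4_2).
Qed.

Lemma cycle_blowup_of_shortest_odd_cycle c :
  shortest_odd_cycle e c -> cycle_blowup e.
Proof.
move=> c_min; have [_ cE _] := c_min.
have twin_exists v := exists_twin v c_min.
exists n, (fun i => [set v | twin e c i v]); split=> // [|u v].
  split=> [i|v]; first by apply/set0Pn; exists (c i); rewrite inE twin_cycle.
  have [j vj] := twin_exists v; exists j; split=> [|i]; rewrite inE // => vi.
  exact: twin_unique c_min vj vi.
split=> [uv|[i]]; last first.
  rewrite !inE ordSE => -[[ui vi]|[vi ui]].
    exact: twin_succ_adj c_min ui vi.
  by rewrite e_sym; apply: twin_succ_adj c_min vi ui.
have [[i ui] [j vj]] := (twin_exists u, twin_exists v).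
by have [ji|ij] := twin_adj c_min ui vj uv; [exists i; left | exists j; right];
  rewrite !inE ordSE -?ji -?ij.
Qed.

End Blowup.

End Classification.

Theorem theorem1p5 (T : finType) (e : rel T) (e_sym : symmetric e)
    (e_irr : irreflexive e) (e_conn : connected_graph e)
    (nu_eta : forall A : {set T}, nu (induced e A) = eta (induced e A)) :
  bipartite e \/ complete_multipartite e \/ cycle_blowup e.
Proof.
have [bip|[k odd_k]] := bipartite_or_odd_closed_walk e_sym e_conn.
  by left.
right; have [m [c c_min]] := exists_shortest_odd_cycle e_irr odd_k.
have [m0|m_gt0] := posnP m.
  by subst m; left; apply: complete_multipartite_of_triangle c_min.
by right; apply: cycle_blowup_of_shortest_odd_cycle c_min.
Qed.
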